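(* Let $a, b > 0$ be real numbers, let $w_n = an+b$ for $n \ge 0$, and let $M$ be the weighted mean operator on $\ell^2$ determined by the sequence $\{w_n\}_{n\ge 0}$, i.e. the operator given by the lower triangular infinite matrix $M = [m_{ij}]_{i,j \ge 0}$ with $m_{ij} = w_j / W_i$ for $j \le i$ and $m_{ij} = 0$ for $j > i$, where $W_i = \sum_{j=0}^{i} w_j$. Then both $M$ and its adjoint $M^*$ are injective and have dense range in $\ell^2$, and $$\operatorname{Ran}(M) = \operatorname{Ran}(M^* ).$$
   Context: Here $\ell^2$ is the Hilbert space of square-summable sequences indexed by $n = 0, 1, 2, \dots$, and an infinite matrix acts on $\ell^2$ with respect to the standard orthonormal basis by $(Mf)_i = \sum_j m_{ij} f_j$; the matrix $M$ defines a bounded linear operator on $\ell^2$. For a bounded operator $A$ on a Hilbert space $H$, $\operatorname{Ran}(A) = \{ g \in H : g = Af \text{ for some } f \in H\}$. *)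

(* Defs.v *)
From Stdlib Require Import Reals Lra Lia Psatz.
From Stdlib Require Import FunctionalExtensionality ProofIrrelevance ClassicalEpsilon.
From Stdlib Require Export FinFun.
From Coquelicot Require Export Coquelicot.

Open Scope R_scope.

(* [Series] is available for real series only. Meaningful for convergent series;
   see [CSeries_correct]. *)
Definition CSeries (u : nat -> C) : C :=
  (Series (fun n => Re (u n)), Series (fun n => Im (u n))).

Lemma RtoC_m1 : RtoC (-1) = (- (1))%C.
Proof. unfold RtoC, Copp; simpl; f_equal; ring. Qed.

Lemma ex_series_nonneg_le (a b : nat -> R) :
  (forall n, 0 <= a n <= b n) -> ex_series b -> ex_series a.
Proof.
  intros H Hb. apply (ex_series_le (K := R_AbsRing) (V := R_CompleteNormedModule) a b).
  - intros n. change (norm (a n)) with (Rabs (a n)). rewrite Rabs_pos_eq; apply H.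
  - exact Hb.
Qed.

Lemma ex_series_Rext (a b : nat -> R) :
  (forall n, a n = b n) -> ex_series a -> ex_series b.
Proof. exact (ex_series_ext (K := R_AbsRing) (V := R_NormedModule) a b). Qed.

Lemma ex_series_Rplus (a b : nat -> R) :
  ex_series a -> ex_series b -> ex_series (fun n => a n + b n).
Proof. exact (ex_series_plus (K := R_AbsRing) (V := R_NormedModule) a b). Qed.

Lemma ex_series_Rscal (c : R) (a : nat -> R) :
  ex_series a -> ex_series (fun n => c * a n).
Proof. exact (ex_series_scal (K := R_AbsRing) (V := R_NormedModule) c a). Qed.

Lemma Series_nonneg (a : nat -> R) :
  (forall n, 0 <= a n) -> ex_series a -> 0 <= Series a.
Proof.
  intros H Ha. replace 0 with (Series (fun n => 0 * a n)).
  - apply Series_le; [|exact Ha]. intros n; specialize (H n); lra.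
  - rewrite Series_scal_l; ring.
Qed.

Lemma Im_le_Cmod (z : C) : Rabs (Im z) <= Cmod z.
Proof.
  rewrite <- (Rabs_pos_eq (Cmod z)) by apply Cmod_ge_0.
  apply Rsqr_le_abs_0. unfold Rsqr. generalize (Cmod2_alt z). nra.
Qed.

Lemma Cmod_le_Re_Im (z : C) : Cmod z <= Rabs (Re z) + Rabs (Im z).
Proof.
  generalize (Cmod2_alt z) (Cmod_ge_0 z) (Rabs_pos (Re z)) (Rabs_pos (Im z)).
  rewrite <- (pow2_abs (Re z)), <- (pow2_abs (Im z)). nra.
Qed.

Lemma ex_series_abs_Re (u : nat -> C) (Hu : ex_series (fun n => Cmod (u n))) : ex_series (fun n => Rabs (Re (u n))).
Proof.
  refine (ex_series_nonneg_le _ _ _ Hu). intros n; split; [apply Rabs_pos|apply re_le_Cmod].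
Qed.

Lemma ex_series_abs_Im (u : nat -> C) (Hu : ex_series (fun n => Cmod (u n))) : ex_series (fun n => Rabs (Im (u n))).
Proof.
  refine (ex_series_nonneg_le _ _ _ Hu). intros n; split; [apply Rabs_pos|apply Im_le_Cmod].
Qed.

Lemma ex_series_Re (u : nat -> C) (Hu : ex_series (fun n => Cmod (u n))) : ex_series (fun n => Re (u n)).
Proof. now apply ex_series_Rabs, ex_series_abs_Re. Qed.

Lemma ex_series_Im (u : nat -> C) (Hu : ex_series (fun n => Cmod (u n))) : ex_series (fun n => Im (u n)).
Proof. now apply ex_series_Rabs, ex_series_abs_Im. Qed.

Lemma Cmod_CSeries (u : nat -> C) (Hu : ex_series (fun n => Cmod (u n))) : Cmod (CSeries u) <= 2 * Series (fun n => Cmod (u n)).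
Proof.
  eapply Rle_trans; [apply Cmod_le_Re_Im|]. simpl.
  assert (H1 : Rabs (Series (fun n => Re (u n))) <= Series (fun n => Cmod (u n))).
  { eapply Rle_trans; [exact (Series_Rabs _ (ex_series_abs_Re u Hu))|].
    apply Series_le; [|exact Hu]. intros n; split; [apply Rabs_pos|apply re_le_Cmod]. }
  assert (H2 : Rabs (Series (fun n => Im (u n))) <= Series (fun n => Cmod (u n))).
  { eapply Rle_trans; [exact (Series_Rabs _ (ex_series_abs_Im u Hu))|].
    apply Series_le; [|exact Hu]. intros n; split; [apply Rabs_pos|apply Im_le_Cmod]. }
  lra.
Qed.

Lemma CSeries_ext (u v : nat -> C) : (forall n, u n = v n) -> CSeries u = CSeries v.
Proof. intros H. unfold CSeries. f_equal; apply Series_ext; intros n; now rewrite H. Qed.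

Lemma CSeries_plus (u v : nat -> C) :
  ex_series (fun n => Cmod (u n)) -> ex_series (fun n => Cmod (v n)) ->
  CSeries (fun n => (u n + v n)%C) = (CSeries u + CSeries v)%C.
Proof.
  intros Hu Hv. unfold CSeries, Cplus; simpl. f_equal; apply Series_plus;
    first [now apply ex_series_Re | now apply ex_series_Im].
Qed.

Lemma CSeries_scal (c : C) (u : nat -> C) :
  ex_series (fun n => Cmod (u n)) ->
  CSeries (fun n => (c * u n)%C) = (c * CSeries u)%C.
Proof.
  intros Hu. pose proof (ex_series_Re u Hu). pose proof (ex_series_Im u Hu).
  unfold CSeries, Cmult; simpl.
  rewrite <- !Series_scal_l, <- Series_minus, <- Series_plus; try now apply ex_series_Rscal.
  reflexivity.
Qed.

Lemma sum_n_C (u : nat -> C) (n : nat) :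
  sum_n u n = (sum_n (fun k => Re (u k)) n, sum_n (fun k => Im (u k)) n).
Proof.
  induction n as [|n IH].
  - rewrite !sum_O. now destruct (u 0%nat).
  - rewrite !sum_Sn, IH. reflexivity.
Qed.

Lemma CSeries_correct (u : nat -> C) (l : C) :
  is_series (K := C_AbsRing) (V := C_NormedModule) u l -> CSeries u = l.
Proof.
  intros H. destruct l as [x y]. unfold CSeries. f_equal; apply is_series_unique.
  - intros P [e He].
    destruct (H (fun z : C => P (fst z))) as [N HN].
    { exists e. intros z Hz. apply He. exact (proj1 Hz). }
    exists N. intros n Hn. specialize (HN n Hn). now rewrite sum_n_C in HN.
  - intros P [e He].
    destruct (H (fun z : C => P (snd z))) as [N HN].
    { exists e. intros z Hz. apply He. exact (proj2 Hz). }
    exists N. intros n Hn. specialize (HN n Hn). now rewrite sum_n_C in HN.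
Qed.

Record l2 := mk_l2 {
  l2_seq :> nat -> C;
  l2_summable : ex_series (fun n => Cmod (l2_seq n) ^ 2)
}.

Lemma l2_ext (f g : l2) : (forall n, f n = g n) -> f = g.
Proof.
  destruct f as [f Hf], g as [g Hg]; simpl; intros H.
  apply functional_extensionality in H. subst g. f_equal. apply proof_irrelevance.
Qed.

Lemma Cmod_plus_sqr_le (x y : C) (t : R) : 0 < t ->
  Cmod (x + y) ^ 2 <= (1 + t) * Cmod x ^ 2 + (1 + / t) * Cmod y ^ 2.
Proof.
  intros Ht. generalize (Cmod_triangle x y) (Cmod_ge_0 (x + y)) (Cmod_ge_0 x) (Cmod_ge_0 y).
  generalize (Cmod (x + y)) (Cmod x) (Cmod y). intros s p q H Hs Hp Hq.
  assert (0 < / t) by now apply Rinv_0_lt_compat.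
  assert (Hk : 2 * (p * q) <= t * p ^ 2 + / t * q ^ 2).
  { assert (0 <= / t * (t * p - q) ^ 2) by (apply Rmult_le_pos; [lra|apply pow2_ge_0]).
    replace (/ t * (t * p - q) ^ 2) with (t * p ^ 2 + / t * q ^ 2 - 2 * (p * q)) in * by (field; lra).
    lra. }
  nra.
Qed.

Lemma l2_plus_summable (f g : l2) : ex_series (fun n => Cmod (f n + g n) ^ 2).
Proof.
  apply ex_series_nonneg_le with (fun n => (1 + 1) * Cmod (f n) ^ 2 + (1 + / 1) * Cmod (g n) ^ 2).
  - intros n; split; [apply pow2_ge_0|]. apply Cmod_plus_sqr_le; lra.
  - apply ex_series_Rplus; apply ex_series_Rscal, l2_summable.
Qed.

Lemma l2_scal_summable (c : C) (f : l2) : ex_series (fun n => Cmod (c * f n) ^ 2).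
Proof.
  apply ex_series_Rext with (fun n => Cmod c ^ 2 * Cmod (f n) ^ 2).
  - intros n. rewrite Cmod_mult. ring.
  - apply ex_series_Rscal, l2_summable.
Qed.

Lemma ex_series_finite (a : nat -> R) (N : nat) :
  (forall n, (N < n)%nat -> a n = 0) -> ex_series a.
Proof.
  intros H. apply (ex_series_incr_n a (S N)).
  exists 0. apply is_series_ext with (fun _ => 0).
  - intros n. symmetry. apply H. lia.
  - change (is_lim_seq (sum_n (fun _ : nat => 0)) 0).
    apply is_lim_seq_ext with (fun _ => 0).
    + intros n. rewrite sum_n_const. ring.
    + apply is_lim_seq_const.
Qed.

Lemma l2_zero_summable : ex_series (fun _ : nat => Cmod 0 ^ 2).
Proof. apply ex_series_finite with O. intros n _. rewrite Cmod_0. ring. Qed.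

Definition l2_plus (f g : l2) : l2 := mk_l2 (fun n => (f n + g n)%C) (l2_plus_summable f g).
Definition l2_scal (c : C) (f : l2) : l2 := mk_l2 (fun n => (c * f n)%C) (l2_scal_summable c f).
Definition l2_zero : l2 := mk_l2 (fun _ => RtoC 0) l2_zero_summable.
Definition l2_opp (f : l2) : l2 := l2_scal (RtoC (-1)) f.

Definition l2_norm (f : l2) : R := sqrt (Series (fun n => Cmod (f n) ^ 2)).

(* Linear in the first argument, conjugate-linear in the second. *)
Definition l2_inner (f g : l2) : C := CSeries (fun n => (f n * Cconj (g n))%C).

Definition l2_ball (f : l2) (e : R) (g : l2) : Prop := l2_norm (l2_plus g (l2_opp f)) < e.

Lemma l2_sqr_nonneg (f : l2) : 0 <= Series (fun n => Cmod (f n) ^ 2).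
Proof. apply Series_nonneg; [intros; apply pow2_ge_0 | apply l2_summable]. Qed.

Lemma l2_norm_nonneg (f : l2) : 0 <= l2_norm f.
Proof. apply sqrt_pos. Qed.

Lemma l2_norm_sqr (f : l2) : l2_norm f ^ 2 = Series (fun n => Cmod (f n) ^ 2).
Proof. apply pow2_sqrt, l2_sqr_nonneg. Qed.

Lemma l2_norm_le (f : l2) (x : R) :
  0 <= x -> Series (fun n => Cmod (f n) ^ 2) <= x ^ 2 -> l2_norm f <= x.
Proof.
  intros Hx H. rewrite <- l2_norm_sqr in H. generalize (l2_norm_nonneg f). nra.
Qed.

Lemma l2_norm_triangle (f g : l2) : l2_norm (l2_plus f g) <= l2_norm f + l2_norm g.
Proof.
  apply le_epsilon. intros e He.
  set (P := l2_norm f + e / 2). set (Q := l2_norm g + e / 2).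
  generalize (l2_norm_nonneg f) (l2_norm_nonneg g) (l2_norm_sqr f) (l2_norm_sqr g).
  intros Hf Hg Ef Eg.
  assert (HP : 0 < P) by (unfold P; lra). assert (HQ : 0 < Q) by (unfold Q; lra).
  replace (l2_norm f + l2_norm g + e) with (P + Q) by (unfold P, Q; lra).
  apply l2_norm_le; [lra|]. simpl l2_seq.
  assert (HPQ : 0 < Q / P) by now apply Rdiv_lt_0_compat.
  assert (HQP : 0 < P / Q) by now apply Rdiv_lt_0_compat.
  apply Rle_trans with ((1 + Q / P) * l2_norm f ^ 2 + (1 + / (Q / P)) * l2_norm g ^ 2).
  - rewrite Ef, Eg, <- !Series_scal_l, <- Series_plus by apply ex_series_Rscal, l2_summable.
    apply Series_le.
    + intros n; split; [apply pow2_ge_0|]. now apply Cmod_plus_sqr_le.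
    + apply ex_series_Rplus; apply ex_series_Rscal, l2_summable.
  - replace (/ (Q / P)) with (P / Q) by (field; lra).
    apply Rle_trans with ((1 + Q / P) * P ^ 2 + (1 + P / Q) * Q ^ 2).
    + apply Rplus_le_compat; apply Rmult_le_compat_l; try lra; unfold P, Q; nra.
    + right. field. lra.
Qed.

Lemma l2_norm_scal (c : C) (f : l2) : l2_norm (l2_scal c f) = Cmod c * l2_norm f.
Proof.
  unfold l2_norm. simpl l2_seq.
  rewrite (Series_ext _ (fun n => Cmod c ^ 2 * Cmod (f n) ^ 2)).
  - rewrite Series_scal_l, sqrt_mult_alt by apply pow2_ge_0.
    rewrite sqrt_pow2 by apply Cmod_ge_0. reflexivity.
  - intros n. rewrite Cmod_mult. ring.
Qed.

Lemma l2_coord_le (f : l2) (n : nat) : Cmod (f n) <= l2_norm f.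
Proof.
  assert (Cmod (f n) ^ 2 <= l2_norm f ^ 2).
  { rewrite l2_norm_sqr.
    apply Rle_trans with (sum_n (fun n => Cmod (f n) ^ 2) n).
    - destruct n as [|n]; [rewrite sum_O; lra|]. rewrite sum_Sn.
      change plus with Rplus. simpl.
      assert (0 <= sum_n (fun n => Cmod (f n) ^ 2) n); [|simpl in *; lra].
      induction n as [|n IH]; [rewrite sum_O; apply pow2_ge_0|].
      rewrite sum_Sn. change plus with Rplus.
      generalize (pow2_ge_0 (Cmod (f (S n)))). simpl in *; lra.
    - apply (is_lim_seq_incr_compare (sum_n (fun n => Cmod (f n) ^ 2))).
      + apply (Series_correct _ (l2_summable f)).
      + intros k. rewrite sum_Sn. change plus with Rplus.
        generalize (pow2_ge_0 (Cmod (f (S k)))). simpl in *; lra. }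
  generalize (l2_norm_nonneg f) (Cmod_ge_0 (f n)). nra.
Qed.

Lemma l2_norm_eq_zero (f : l2) : l2_norm f = 0 -> f = l2_zero.
Proof.
  intros H. apply l2_ext. intros n. apply Cmod_eq_0.
  generalize (l2_coord_le f n) (Cmod_ge_0 (f n)). lra.
Qed.

Lemma l2_norm_zero : l2_norm l2_zero = 0.
Proof.
  replace l2_zero with (l2_scal 0 l2_zero).
  - rewrite l2_norm_scal, Cmod_0. ring.
  - apply l2_ext. intros n. simpl. ring.
Qed.

Definition l2_AbelianMonoid_mixin : AbelianMonoid.mixin_of l2.
Proof.
  apply (AbelianMonoid.Mixin l2 l2_plus l2_zero);
    intros; apply l2_ext; intros n; simpl; ring.
Defined.

Canonical l2_AbelianMonoid := AbelianMonoid.Pack l2 l2_AbelianMonoid_mixin l2.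

Definition l2_AbelianGroup_mixin : AbelianGroup.mixin_of l2_AbelianMonoid.
Proof.
  apply (AbelianGroup.Mixin l2_AbelianMonoid l2_opp).
  intros; apply l2_ext; intros n; simpl.
  rewrite RtoC_m1. ring.
Defined.

Canonical l2_AbelianGroup :=
  AbelianGroup.Pack l2 (AbelianGroup.Class l2 l2_AbelianMonoid_mixin l2_AbelianGroup_mixin) l2.

Definition l2_ModuleSpace_mixin : ModuleSpace.mixin_of C_Ring l2_AbelianGroup.
Proof.
  apply (ModuleSpace.Mixin C_Ring l2_AbelianGroup l2_scal);
    intros; apply l2_ext; intros n; simpl;
    change (@mult C_Ring) with Cmult; change (@one C_Ring) with (RtoC 1);
    change (@plus C_Ring) with Cplus; ring.
Defined.

Canonical l2_ModuleSpace :=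
  ModuleSpace.Pack C_Ring l2 (ModuleSpace.Class C_Ring l2 _ l2_ModuleSpace_mixin) l2.

Lemma l2_opp_minus (f g h : l2) :
  l2_plus h (l2_opp f) = l2_plus (l2_plus g (l2_opp f)) (l2_plus h (l2_opp g)).
Proof.
  apply l2_ext. intros n; simpl.
  rewrite RtoC_m1. ring.
Qed.

Definition l2_UniformSpace_mixin : UniformSpace.mixin_of l2.
Proof.
  apply (UniformSpace.Mixin l2 l2_zero l2_ball); unfold l2_ball.
  - intros f e. pose proof (plus_opp_r (G := l2_AbelianGroup) f) as E.
    change (l2_plus f (l2_opp f) = l2_zero) in E. rewrite E, l2_norm_zero. apply cond_pos.
  - intros f g e H.
    replace (l2_plus f (l2_opp g)) with (l2_scal (RtoC (-1)) (l2_plus g (l2_opp f))).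
    + rewrite l2_norm_scal, Cmod_R, Rabs_left by lra. lra.
    + apply l2_ext; intros n; simpl.
      rewrite RtoC_m1. ring.
  - intros f g h e1 e2 H1 H2. rewrite (l2_opp_minus f g h).
    eapply Rle_lt_trans; [apply l2_norm_triangle|]. lra.
Defined.

Canonical l2_UniformSpace := UniformSpace.Pack l2 l2_UniformSpace_mixin l2.

Canonical l2_NormedModuleAux :=
  NormedModuleAux.Pack C_AbsRing l2
    (NormedModuleAux.Class C_AbsRing l2
       (ModuleSpace.class C_Ring l2_ModuleSpace) (UniformSpace.class l2_UniformSpace)) l2.

Definition l2_NormedModule_mixin : NormedModule.mixin_of C_AbsRing l2_NormedModuleAux.
Proof.
  apply (NormedModule.Mixin C_AbsRing l2_NormedModuleAux l2_norm 1).
  - exact l2_norm_triangle.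
  - intros c f. right. exact (l2_norm_scal c f).
  - intros f g e H. exact H.
  - intros f g e H. rewrite Rmult_1_l. exact H.
  - exact l2_norm_eq_zero.
Defined.

Canonical l2_NormedModule :=
  NormedModule.Pack C_AbsRing l2
    (NormedModule.Class C_AbsRing l2 _ l2_NormedModule_mixin) l2.

(* Coquelicot's [is_linear] includes boundedness of the map. *)
Record bounded_op := mk_bounded_op {
  op_fun :> l2 -> l2;
  op_is_linear : is_linear op_fun
}.

Definition Ran (A : l2 -> l2) (g : l2) : Prop := exists f : l2, g = A f.

Definition dense (D : l2 -> Prop) : Prop :=
  forall (g : l2) (e : posreal), exists h : l2, D h /\ ball g e h.

Definition is_adjoint (A B : l2 -> l2) : Prop :=
  forall f g : l2, l2_inner (A f) g = l2_inner f (B g).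

Lemma l2_inner_abs (f g : l2) :
  ex_series (fun n => Cmod (f n * Cconj (g n))) /\
  Series (fun n => Cmod (f n * Cconj (g n))) <= l2_norm f * l2_norm g.
Proof.
  assert (K : forall t, 0 < t -> forall n,
    0 <= Cmod (f n * Cconj (g n)) <= / 2 * (t * Cmod (f n) ^ 2 + / t * Cmod (g n) ^ 2)).
  { intros t Ht n. split; [apply Cmod_ge_0|]. rewrite Cmod_mult, Cmod_conj.
    generalize (Cmod (f n)) (Cmod (g n)). intros p q.
    assert (0 < / t) by now apply Rinv_0_lt_compat.
    assert (0 <= / t * (t * p - q) ^ 2) by (apply Rmult_le_pos; [lra|apply pow2_ge_0]).
    replace (/ t * (t * p - q) ^ 2) with (t * p ^ 2 + / t * q ^ 2 - 2 * (p * q)) in * by (field; lra).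
    lra. }
  assert (E : forall t, ex_series (fun n => / 2 * (t * Cmod (f n) ^ 2 + / t * Cmod (g n) ^ 2))).
  { intros t. apply ex_series_Rscal, ex_series_Rplus; apply ex_series_Rscal, l2_summable. }
  split; [exact (ex_series_nonneg_le _ _ (K 1 Rlt_0_1) (E 1))|].
  generalize (l2_norm_nonneg f) (l2_norm_nonneg g) (l2_norm_sqr f) (l2_norm_sqr g).
  intros Hf Hg Ef Eg.
  assert (B : forall e, 0 < e ->
    Series (fun n => Cmod (f n * Cconj (g n))) <= (l2_norm f + e) * (l2_norm g + e)).
  { intros e He. set (P := l2_norm f + e). set (Q := l2_norm g + e).
    assert (HP : 0 < P) by (unfold P; lra). assert (HQ : 0 < Q) by (unfold Q; lra).
    assert (HPQ : 0 < Q / P) by now apply Rdiv_lt_0_compat.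
    assert (HQP : 0 < P / Q) by now apply Rdiv_lt_0_compat.
    eapply Rle_trans; [exact (Series_le _ _ (K _ HPQ) (E _))|].
    rewrite Series_scal_l, Series_plus by apply ex_series_Rscal, l2_summable.
    rewrite !Series_scal_l, <- Ef, <- Eg.
    replace (/ (Q / P)) with (P / Q) by (field; lra).
    apply Rle_trans with (/ 2 * (Q / P * P ^ 2 + P / Q * Q ^ 2)).
    - apply Rmult_le_compat_l; [lra|].
      apply Rplus_le_compat; apply Rmult_le_compat_l; try lra; unfold P, Q; nra.
    - right. field. lra. }
  apply le_epsilon. intros d Hd.
  set (s := l2_norm f + l2_norm g + 1).
  assert (Hs : 0 < s) by (unfold s; lra).
  set (e := Rmin 1 (d / s)).
  assert (He : 0 < e) by (apply Rmin_glb_lt; [lra|now apply Rdiv_lt_0_compat]).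
  assert (He1 : e <= 1) by apply Rmin_l.
  assert (He2 : e * s <= d).
  { apply Rle_trans with (d / s * s); [|right; field; lra].
    apply Rmult_le_compat_r; [lra|apply Rmin_r]. }
  eapply Rle_trans; [exact (B e He)|]. unfold s in He2. nra.
Qed.

Lemma Cmod_l2_inner (f g : l2) : Cmod (l2_inner f g) <= 2 * (l2_norm f * l2_norm g).
Proof.
  destruct (l2_inner_abs f g) as [H1 H2].
  eapply Rle_trans; [exact (Cmod_CSeries _ H1)|]. lra.
Qed.

Lemma l2_inner_plus_l (f g h : l2) :
  l2_inner (l2_plus f g) h = (l2_inner f h + l2_inner g h)%C.
Proof.
  unfold l2_inner. rewrite <- CSeries_plus by apply l2_inner_abs.
  apply CSeries_ext. intros n; simpl. ring.
Qed.

Lemma l2_inner_scal_l (c : C) (f h : l2) :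
  l2_inner (l2_scal c f) h = (c * l2_inner f h)%C.
Proof.
  unfold l2_inner. rewrite <- CSeries_scal by apply l2_inner_abs.
  apply CSeries_ext. intros n; simpl. ring.
Qed.

Lemma l2_trunc_summable (u : nat -> C) (N : nat) :
  ex_series (fun n => Cmod (if (n <? N)%nat then u n else 0) ^ 2).
Proof.
  apply ex_series_finite with N. intros n Hn.
  destruct (Nat.ltb_spec n N); [lia|]. rewrite Cmod_0. ring.
Qed.

Definition l2_trunc (u : nat -> C) (N : nat) : l2 :=
  mk_l2 (fun n => if (n <? N)%nat then u n else RtoC 0) (l2_trunc_summable u N).

Lemma l2_delta_summable (k : nat) :
  ex_series (fun n => Cmod (if (n =? k)%nat then 1 else 0) ^ 2).
Proof.
  apply ex_series_finite with k. intros n Hn.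
  destruct (Nat.eqb_spec n k); [lia|]. rewrite Cmod_0. ring.
Qed.

Definition l2_delta (k : nat) : l2 :=
  mk_l2 (fun n => if (n =? k)%nat then RtoC 1 else RtoC 0) (l2_delta_summable k).

Lemma l2_trunc_0 (u : nat -> C) : l2_trunc u 0 = l2_zero.
Proof. apply l2_ext. reflexivity. Qed.

Lemma l2_trunc_S (u : nat -> C) (N : nat) :
  l2_trunc u (S N) = l2_plus (l2_trunc u N) (l2_scal (u N) (l2_delta N)).
Proof.
  apply l2_ext. intros n; simpl.
  destruct (Nat.ltb_spec n (S N)), (Nat.ltb_spec n N), (Nat.eqb_spec n N);
    try lia; subst; ring.
Qed.

Lemma l2_trunc_approx (f : l2) (e : R) : 0 < e ->
  exists N, l2_norm (l2_plus f (l2_opp (l2_trunc f N))) < e.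
Proof.
  intros He. pose proof (Series_correct _ (l2_summable f)) as HS.
  destruct (HS (fun x => Rabs (x - Series (fun n => Cmod (f n) ^ 2)) < e ^ 2 / 2)) as [N HN].
  { exists (mkposreal (e ^ 2 / 2) ltac:(simpl; nra)). intros y Hy. exact Hy. }
  specialize (HN N (Nat.le_refl N)). exists (S N).
  rewrite (Series_incr_n _ (S N) ltac:(lia) (l2_summable f)) in HN.
  simpl pred in HN. rewrite <- sum_n_Reals in HN.
  assert (E : l2_norm (l2_plus f (l2_opp (l2_trunc f (S N)))) ^ 2 =
    Series (fun k => Cmod (f (S N + k)%nat) ^ 2)).
  { rewrite l2_norm_sqr, (Series_incr_n _ (S N) ltac:(lia) (l2_summable _)).
    simpl pred. rewrite <- sum_n_Reals.
    rewrite (sum_n_ext_loc _ (fun _ => 0)), sum_n_const.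
    - rewrite Rmult_0_r, Rplus_0_l. apply Series_ext. intros n. simpl l2_seq.
      destruct (Nat.ltb_spec (S (N + n)) (S N)); [lia|].
      simpl plus. replace (f (S (N + n)) + RtoC (-1) * 0)%C with (f (S (N + n))) by ring.
      reflexivity.
    - intros n Hn. simpl l2_seq. destruct (Nat.ltb_spec n (S N)); [|lia].
      replace (f n + RtoC (-1) * f n)%C with (RtoC 0).
      { rewrite Cmod_0. change (0 ^ 2 = 0). ring. }
      rewrite RtoC_m1. ring. }
  set (r := Series (fun k => Cmod (f (S N + k)%nat) ^ 2)) in *.
  assert (HN' : forall x : R, Rabs (x - (x + r)) < e ^ 2 / 2 -> Rabs r < e ^ 2 / 2).
  { intros x. replace (x - (x + r)) with (- r) by ring. now rewrite Rabs_Ropp. }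
  apply HN' in HN. clear HN'. pose proof (Rle_abs r).
  generalize (l2_norm_nonneg (l2_plus f (l2_opp (l2_trunc f (S N))))). nra.
Qed.

Lemma l2_functional_zero (L : l2 -> C) (K : R) :
  (forall f g, L (l2_plus f g) = (L f + L g)%C) ->
  (forall c f, L (l2_scal c f) = (c * L f)%C) ->
  (forall f, Cmod (L f) <= K * l2_norm f) ->
  (forall n, L (l2_delta n) = RtoC 0) ->
  forall f, L f = RtoC 0.
Proof.
  intros Lp Ls LK Ld f.
  assert (L0 : L l2_zero = RtoC 0).
  { apply Cmod_eq_0. generalize (LK l2_zero) (Cmod_ge_0 (L l2_zero)).
    rewrite l2_norm_zero. lra. }
  assert (Lt : forall N, L (l2_trunc f N) = RtoC 0).
  { induction N as [|N IH]; [now rewrite l2_trunc_0|].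
    rewrite l2_trunc_S, Lp, Ls, IH, Ld. ring. }
  apply Cmod_eq_0. apply Rle_antisym; [|apply Cmod_ge_0].
  apply le_epsilon. intros e He. rewrite Rplus_0_l.
  pose proof (Rabs_pos K) as HK. pose proof (Rle_abs K).
  destruct (l2_trunc_approx f (e / (Rabs K + 1))) as [N HN].
  { apply Rdiv_lt_0_compat; lra. }
  assert (E : L f = L (l2_plus f (l2_opp (l2_trunc f N)))).
  { unfold l2_opp. rewrite Lp, Ls, Lt. ring. }
  rewrite E. eapply Rle_trans; [apply LK|].
  pose proof (l2_norm_nonneg (l2_plus f (l2_opp (l2_trunc f N)))).
  apply Rle_trans with ((Rabs K + 1) * (e / (Rabs K + 1))); [|right; field; lra]. nra.
Qed.

Lemma l2_inner_delta_l (n : nat) (g : l2) : l2_inner (l2_delta n) g = Cconj (g n).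
Proof.
  assert (D : forall a : nat -> R, Series (fun k => if (k =? n)%nat then a k else 0) = a n).
  { intros a.
    set (d := fun k : nat => if (k =? n)%nat then a k else 0).
    assert (Z : forall k, k <> n -> d k = 0).
    { intros k Hk. unfold d. destruct (Nat.eqb_spec k n); [easy|reflexivity]. }
    assert (Dn : d n = a n) by (unfold d; now rewrite Nat.eqb_refl).
    assert (E : ex_series d) by (apply ex_series_finite with n; intros k Hk; apply Z; lia).
    rewrite (Series_incr_n _ (S n) ltac:(lia) E). simpl pred. rewrite <- sum_n_Reals.
    rewrite (Series_ext _ (fun k => 0 * 0)), Series_scal_l.
    2:{ intros k. rewrite Z by lia. ring. }
    rewrite Rmult_0_l, Rplus_0_r, <- Dn.
    assert (Y : forall m, (m < n)%nat -> sum_n d m = 0).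
    { intros m Hm. rewrite (sum_n_ext_loc _ (fun _ => 0)).
      - rewrite sum_n_const. apply Rmult_0_r.
      - intros k Hk. apply Z. lia. }
    destruct n as [|n']; [now rewrite sum_O|].
    rewrite sum_Sn, Y by lia. apply Rplus_0_l. }
  unfold l2_inner, CSeries. rewrite (surjective_pairing (Cconj (g n))). f_equal.
  - rewrite <- (D (fun k => fst (Cconj (g k)))). apply Series_ext. intros k. simpl.
    destruct (k =? n)%nat; simpl; ring.
  - rewrite <- (D (fun k => snd (Cconj (g k)))). apply Series_ext. intros k. simpl.
    destruct (k =? n)%nat; simpl; ring.
Qed.

Lemma l2_summable_of_bound (u : nat -> C) (K : R) :
  (forall N, l2_norm (l2_trunc u N) <= K) -> ex_series (fun n => Cmod (u n) ^ 2).
Proof.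
  intros H. apply ex_finite_lim_seq_incr with (M := K ^ 2).
  - intros n. rewrite sum_Sn. change plus with Rplus.
    generalize (pow2_ge_0 (Cmod (u (S n)))). simpl in *; lra.
  - intros n. specialize (H (S n)). pose proof (l2_norm_nonneg (l2_trunc u (S n))).
    apply Rle_trans with (l2_norm (l2_trunc u (S n)) ^ 2); [|nra].
    rewrite l2_norm_sqr.
    apply Rle_trans with (sum_n (fun k => Cmod (l2_trunc u (S n) k) ^ 2) n).
    + right. apply sum_n_ext_loc. intros k Hk. simpl l2_seq.
      destruct (Nat.ltb_spec k (S n)); [easy|lia].
    + apply (is_lim_seq_incr_compare (sum_n (fun k => Cmod (l2_trunc u (S n) k) ^ 2))).
      * apply (Series_correct _ (l2_summable _)).
      * intros k. rewrite sum_Sn. change plus with Rplus.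
        generalize (pow2_ge_0 (Cmod (l2_trunc u (S n) (S k)))). simpl in *; lra.
Qed.

Lemma adjoint_exists_at (A : bounded_op) (g : l2) :
  exists h : l2, forall f, l2_inner (A f) g = l2_inner f h.
Proof.
  destruct (op_is_linear A) as [Ap As [K [HK AK]]].
  set (u := fun n => Cconj (l2_inner (A (l2_delta n)) g)).
  assert (Lp : forall f f', l2_inner (A (l2_plus f f')) g =
    (l2_inner (A f) g + l2_inner (A f') g)%C).
  { intros f f'. rewrite <- l2_inner_plus_l. f_equal. apply Ap. }
  assert (Ls : forall c f, l2_inner (A (l2_scal c f)) g = (c * l2_inner (A f) g)%C).
  { intros c f. rewrite <- l2_inner_scal_l. f_equal. apply As. }
  assert (LK : forall f, Cmod (l2_inner (A f) g) <= 2 * K * l2_norm g * l2_norm f).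
  { intros f. eapply Rle_trans; [apply Cmod_l2_inner|].
    assert (l2_norm (A f) <= K * l2_norm f) by apply AK.
    pose proof (l2_norm_nonneg g). nra. }
  assert (Lt : forall N, l2_inner (A (l2_trunc u N)) g = RtoC (l2_norm (l2_trunc u N) ^ 2)).
  { induction N as [|N IH].
    - rewrite l2_trunc_0, l2_norm_zero.
      replace (RtoC (0 ^ 2)) with (RtoC 0) by (f_equal; ring). apply Cmod_eq_0.
      generalize (LK l2_zero) (Cmod_ge_0 (l2_inner (A l2_zero) g)). rewrite l2_norm_zero.
      lra.
    - rewrite l2_trunc_S at 1. rewrite Lp, Ls, IH.
      replace (u N * l2_inner (A (l2_delta N)) g)%C with (RtoC (Cmod (u N) ^ 2)).
      2:{ unfold u. rewrite Cmod_conj, Cmod2_conj. ring. }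
      rewrite <- RtoC_plus. f_equal. rewrite !l2_norm_sqr.
      assert (F : forall M, Series (fun n => Cmod (l2_trunc u (S M) n) ^ 2) =
        sum_n (fun n => Cmod (u n) ^ 2) M).
      { intros M. rewrite (Series_incr_n _ (S M) ltac:(lia) (l2_summable _)).
        simpl pred. rewrite <- sum_n_Reals.
        rewrite (Series_ext _ (fun k => 0 * 0)), Series_scal_l, Rmult_0_l, Rplus_0_r.
        - apply sum_n_ext_loc. intros k Hk. simpl l2_seq.
          destruct (Nat.ltb_spec k (S M)); [easy|lia].
        - intros k. simpl l2_seq. destruct (Nat.ltb_spec (S (M + k)) (S M)); [lia|].
          rewrite Cmod_0. ring. }
      destruct N as [|N].
      + rewrite F, sum_O, <- l2_norm_sqr, l2_trunc_0, l2_norm_zero. ring.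
      + rewrite !F, sum_Sn. reflexivity. }
  assert (Hu : ex_series (fun n => Cmod (u n) ^ 2)).
  { apply l2_summable_of_bound with (2 * K * l2_norm g). intros N.
    pose proof (l2_norm_nonneg g). pose proof (l2_norm_nonneg (l2_trunc u N)) as H0.
    pose proof (LK (l2_trunc u N)) as H1. rewrite Lt, Cmod_R, Rabs_pos_eq in H1 by apply pow2_ge_0.
    destruct H0 as [H0|H0]; [|rewrite <- H0; nra].
    apply Rmult_le_reg_r with (1 := H0). nra. }
  exists (mk_l2 u Hu). intros f.
  cut (l2_inner (A f) g - l2_inner f (mk_l2 u Hu) = RtoC 0)%C.
  { intros E. replace (l2_inner (A f) g) with
      (l2_inner (A f) g - l2_inner f (mk_l2 u Hu) + l2_inner f (mk_l2 u Hu))%C by ring.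
    rewrite E. ring. }
  revert f. apply (l2_functional_zero _ (2 * K * l2_norm g + 2 * l2_norm (mk_l2 u Hu))).
  - intros f f'. rewrite Lp, l2_inner_plus_l. ring.
  - intros c f. rewrite Ls, l2_inner_scal_l. ring.
  - intros f. unfold Cminus. eapply Rle_trans; [apply Cmod_triangle|].
    rewrite Cmod_opp. generalize (LK f) (Cmod_l2_inner f (mk_l2 u Hu)). nra.
  - intros n. rewrite l2_inner_delta_l. simpl. unfold u. rewrite Cconj_conj. ring.
Qed.

Lemma adjoint_exists (A : bounded_op) : exists B : l2 -> l2, is_adjoint A B.
Proof.
  exists (fun g => proj1_sig (constructive_indefinite_description _ (adjoint_exists_at A g))).
  intros f g.
  exact (proj2_sig (constructive_indefinite_description _ (adjoint_exists_at A g)) f).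
Qed.

Definition adjoint (A : bounded_op) : l2 -> l2 :=
  proj1_sig (constructive_indefinite_description _ (adjoint_exists A)).

Lemma adjoint_spec (A : bounded_op) : is_adjoint A (adjoint A).
Proof. exact (proj2_sig (constructive_indefinite_description _ (adjoint_exists A))). Qed.

Lemma adjoint_unique (A : bounded_op) (B : l2 -> l2) : is_adjoint A B -> B = adjoint A.
Proof.
  intros H. apply functional_extensionality. intros g. apply l2_ext. intros n.
  rewrite <- (Cconj_conj (B g n)), <- (Cconj_conj (adjoint A g n)). f_equal.
  rewrite <- !l2_inner_delta_l, <- H, <- (adjoint_spec A). reflexivity.
Qed.

Definition matrix_apply (m : nat -> nat -> C) (f : nat -> C) (i : nat) : C :=
  CSeries (fun j => (m i j * f j)%C).

(* [CSeries] is a default value on divergent series, so the convergence of each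
   row sum is part of the definition. *)
Record bounded_matrix (m : nat -> nat -> C) : Prop := mk_bounded_matrix {
  bm_rows : forall (f : l2) (i : nat), ex_series (fun j => Cmod (m i j * f j));
  bm_summable : forall f : l2, ex_series (fun i => Cmod (matrix_apply m f i) ^ 2);
  bm_bound : exists K : R, forall f : l2,
    Series (fun i => Cmod (matrix_apply m f i) ^ 2) <= K * Series (fun i => Cmod (f i) ^ 2)
}.

Lemma matrix_is_linear (m : nat -> nat -> C) (Hm : bounded_matrix m) :
  is_linear (fun f : l2 => mk_l2 (matrix_apply m f) (bm_summable m Hm f)).
Proof.
  split.
  - intros f g. apply l2_ext. intros i. simpl. unfold matrix_apply.
    rewrite <- CSeries_plus by apply (bm_rows m Hm).
    apply CSeries_ext. intros j; simpl; ring.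
  - intros c f. apply l2_ext. intros i. simpl. unfold matrix_apply.
    rewrite <- CSeries_scal by apply (bm_rows m Hm).
    apply CSeries_ext. intros j; simpl; ring.
  - destruct (bm_bound m Hm) as [K HK]. exists (Rabs K + 1).
    pose proof (Rabs_pos K). pose proof (Rle_abs K). split; [lra|]. intros f.
    change (l2_norm (mk_l2 (matrix_apply m f) (bm_summable m Hm f)) <= (Rabs K + 1) * l2_norm f).
    pose proof (l2_norm_nonneg f).
    apply l2_norm_le; [nra|]. simpl l2_seq. eapply Rle_trans; [apply HK|].
    rewrite <- l2_norm_sqr, Rpow_mult_distr.
    apply Rmult_le_compat_r; [apply pow2_ge_0|]. nra.
Qed.

Definition matrix_op (m : nat -> nat -> C) (Hm : bounded_matrix m) : bounded_op :=
  mk_bounded_op _ (matrix_is_linear m Hm).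

(* [sum_n w i] is w 0 + ... + w i, inclusive. *)
Definition weighted_mean_matrix (w : nat -> R) (i j : nat) : C :=
  if (j <=? i)%nat then RtoC (w j / sum_n w i) else RtoC 0.

Lemma CSeries_finite (u : nat -> C) (N : nat) :
  (forall n, (N < n)%nat -> u n = RtoC 0) -> CSeries u = sum_n u N.
Proof.
  intros H. rewrite sum_n_C. unfold CSeries.
  assert (F : forall a : nat -> R, (forall n, (N < n)%nat -> a n = 0) -> Series a = sum_n a N).
  { intros a Ha. rewrite (Series_incr_n _ (S N) ltac:(lia) (ex_series_finite _ _ Ha)).
    simpl pred. rewrite <- sum_n_Reals.
    rewrite (Series_ext _ (fun k => 0 * 0)), Series_scal_l; [ring|].
    intros k. rewrite Ha by lia. ring. }
  apply injective_projections; simpl; apply F; intros n Hn; now rewrite H.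
Qed.

Lemma affine_partial_sum (a b : R) (i : nat) :
  sum_n (fun n => a * INR n + b) i = (INR i + 1) * (a * INR i / 2 + b).
Proof.
  induction i as [|i IH]; [rewrite sum_O; simpl; field|].
  rewrite sum_Sn, IH, S_INR. change plus with Rplus. simpl. field.
Qed.

Lemma hardy_inequality (x : nat -> R) :
  (forall n, 0 <= x n) -> ex_series (fun n => x n ^ 2) ->
  ex_series (fun n => (sum_n x n / (INR n + 1)) ^ 2) /\
  Series (fun n => (sum_n x n / (INR n + 1)) ^ 2) <= 4 * Series (fun n => x n ^ 2).
Proof.
  intros Hx Hs. set (A := fun n => sum_n x n / (INR n + 1)).
  assert (P : forall N, sum_n (fun n => A n ^ 2 - 2 * A n * x n) N + (INR N + 1) * A N ^ 2 <= 0).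
  { induction N as [|N IH].
    - rewrite sum_O. unfold A. rewrite sum_O. simpl. right. field.
    - rewrite sum_Sn. change plus with Rplus. rewrite S_INR.
      pose proof (pos_INR N) as HN.
      assert (EA : x (S N) = (INR N + 2) * A (S N) - (INR N + 1) * A N).
      { unfold A. rewrite sum_Sn, S_INR. change plus with Rplus. simpl. field. lra. }
      rewrite EA. pose proof (pow2_ge_0 (A (S N) - A N)). simpl in *. nra. }
  assert (B : forall N, sum_n (fun n => A n ^ 2) N <= 4 * sum_n (fun n => x n ^ 2) N).
  { intros N.
    assert (Q : sum_n (fun n => A n ^ 2) N <=
      2 * sum_n (fun n => A n ^ 2 - 2 * A n * x n) N + 4 * sum_n (fun n => x n ^ 2) N).
    { induction N as [|N IH].
      - rewrite !sum_O. pose proof (pow2_ge_0 (A 0%nat - 2 * x 0%nat)). simpl in *. nra.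
      - rewrite !sum_Sn. change plus with Rplus.
        pose proof (pow2_ge_0 (A (S N) - 2 * x (S N))). simpl in *. nra. }
    pose proof (P N). pose proof (pos_INR N). pose proof (pow2_ge_0 (A N)). nra. }
  assert (X : forall N, sum_n (fun n => x n ^ 2) N <= Series (fun n => x n ^ 2)).
  { apply is_lim_seq_incr_compare; [apply (Series_correct _ Hs)|].
    intros k. rewrite sum_Sn. change plus with Rplus.
    generalize (pow2_ge_0 (x (S k))). simpl in *; lra. }
  assert (E : ex_series (fun n => A n ^ 2)).
  { apply ex_finite_lim_seq_incr with (M := 4 * Series (fun n => x n ^ 2)).
    - intros k. rewrite sum_Sn. change plus with Rplus.
      generalize (pow2_ge_0 (A (S k))). simpl in *; lra.
    - intros N. eapply Rle_trans; [apply B|]. specialize (X N). lra. }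
  split; [exact E|].
  apply (is_lim_seq_le (sum_n (fun n => A n ^ 2)) (fun _ => 4 * Series (fun n => x n ^ 2))
    (Series (fun n => A n ^ 2)) (4 * Series (fun n => x n ^ 2))).
  - intros N. eapply Rle_trans; [apply B|]. specialize (X N). lra.
  - apply (Series_correct _ E).
  - apply is_lim_seq_const.
Qed.

Lemma affine_weighted_mean_bounded (a b : R) (ha : 0 < a) (hb : 0 < b) :
  bounded_matrix (weighted_mean_matrix (fun n => a * INR n + b)).
Proof.
  set (m := weighted_mean_matrix (fun n => a * INR n + b)).
  assert (Z : forall (f : l2) i j, (i < j)%nat -> (m i j * f j)%C = RtoC 0).
  { intros f i j Hj. unfold m, weighted_mean_matrix.
    destruct (Nat.leb_spec j i); [lia|]. ring. }
  assert (W : forall i j, Cmod (m i j) <= 2 / (INR i + 1)).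
  { intros i j. pose proof (pos_INR i) as Hi. pose proof (pos_INR j) as Hj.
    assert (0 < 2 / (INR i + 1)) by (apply Rdiv_lt_0_compat; lra).
    unfold m, weighted_mean_matrix. destruct (Nat.leb_spec j i) as [Hij|Hij].
    - rewrite Cmod_R, affine_partial_sum. apply le_INR in Hij.
      assert (0 < a * INR i / 2 + b) by nra.
      assert (0 < (INR i + 1) * (a * INR i / 2 + b)) by nra.
      rewrite Rabs_pos_eq.
      2:{ apply Rmult_le_pos; [nra|]. now apply Rlt_le, Rinv_0_lt_compat. }
      replace (2 / (INR i + 1)) with
        ((2 * (a * INR i / 2 + b)) / ((INR i + 1) * (a * INR i / 2 + b))) by (field; lra).
      apply Rmult_le_compat_r; [now apply Rlt_le, Rinv_0_lt_compat|]. nra.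
    - rewrite Cmod_0. lra. }
  assert (T : forall (f : l2) i,
    Cmod (matrix_apply m f i) <= 2 * (sum_n (fun j => Cmod (f j)) i / (INR i + 1))).
  { intros f i. unfold matrix_apply. rewrite (CSeries_finite _ i) by apply Z.
    pose proof (pos_INR i) as Hi.
    replace (2 * (sum_n (fun j => Cmod (f j)) i / (INR i + 1))) with
      (2 / (INR i + 1) * sum_n (fun j => Cmod (f j)) i) by (field; lra).
    assert (G : forall N, Cmod (sum_n (fun j => (m i j * f j)%C) N) <=
      2 / (INR i + 1) * sum_n (fun j => Cmod (f j)) N); [|apply G].
    induction N as [|N IH].
    - rewrite !sum_O, Cmod_mult. apply Rmult_le_compat_r; [apply Cmod_ge_0|apply W].
    - rewrite !sum_Sn. change (@plus R_AbelianMonoid) with Rplus.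
      eapply Rle_trans; [apply Cmod_triangle|]. rewrite Rmult_plus_distr_l.
      apply Rplus_le_compat; [exact IH|]. rewrite Cmod_mult.
      apply Rmult_le_compat_r; [apply Cmod_ge_0|apply W]. }
  assert (T2 : forall (f : l2) i, 0 <= Cmod (matrix_apply m f i) ^ 2 <=
    4 * (sum_n (fun j => Cmod (f j)) i / (INR i + 1)) ^ 2).
  { intros f i. split; [apply pow2_ge_0|].
    pose proof (T f i). pose proof (Cmod_ge_0 (matrix_apply m f i)). nra. }
  assert (H : forall f : l2, _) by
    exact (fun f : l2 => hardy_inequality (fun j => Cmod (f j)) (fun j => Cmod_ge_0 _) (l2_summable f)).
  split.
  - intros f i. apply ex_series_finite with i. intros j Hj. rewrite Z by easy. apply Cmod_0.
  - intros f. apply (ex_series_nonneg_le _ _ (T2 f)), ex_series_Rscal, H.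
  - exists 16. intros f. destruct (H f) as [H1 H2].
    eapply Rle_trans; [apply (Series_le _ _ (T2 f)), ex_series_Rscal, H1|].
    rewrite Series_scal_l. lra.
Qed.

(* Main.v *)
Require Import Defs.
From Stdlib Require Import Reals Lra Lia FinFun.
From Coquelicot Require Import Coquelicot.
Open Scope R_scope.

(** Write [W n] for the partial sums of [w]. Inverting the triangular matrix gives, for [g = M f],
    [f (n+1) = g (n+1) + d n] with [d n = W n / w (n+1) * (g (n+1) - g n)], and, for [h = M* k],
    [k n = W n * (1 / w n - 1 / w (n+1)) * h n - d n] with the same expression [d] formed from [h].
    For affine [w] the factor of [h n] lies in [[0, 1]], so both ranges consist of the
    sequences for which [d] is square-summable. *)

(** * Square-summability and a density criterion *)

Lemma l2_summable_plus (u v : nat -> C) :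
  ex_series (fun n => Cmod (u n) ^ 2) -> ex_series (fun n => Cmod (v n) ^ 2) ->
  ex_series (fun n => Cmod (u n + v n) ^ 2).
Proof. intros Hu Hv. exact (l2_plus_summable (mk_l2 u Hu) (mk_l2 v Hv)). Qed.

Lemma l2_summable_opp (u : nat -> C) :
  ex_series (fun n => Cmod (u n) ^ 2) -> ex_series (fun n => Cmod (- u n) ^ 2).
Proof. apply ex_series_Rext. intros n. now rewrite Cmod_opp. Qed.

Lemma l2_summable_shift (u : nat -> C) :
  ex_series (fun n => Cmod (u n) ^ 2) <-> ex_series (fun n => Cmod (u (S n)) ^ 2).
Proof. exact (ex_series_incr_1 (fun n => Cmod (u n) ^ 2)). Qed.

Lemma l2_summable_mult_bounded (c : nat -> R) (K : R) (u : nat -> C) :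
  (forall n, Rabs (c n) <= K) -> ex_series (fun n => Cmod (u n) ^ 2) ->
  ex_series (fun n => Cmod (RtoC (c n) * u n) ^ 2).
Proof.
  intros Hc Hu. apply ex_series_nonneg_le with (fun n => K ^ 2 * Cmod (u n) ^ 2).
  - intros n. split; [apply pow2_ge_0|].
    rewrite Cmod_mult, Cmod_R, Rpow_mult_distr.
    apply Rmult_le_compat_r; [apply pow2_ge_0|].
    apply pow_incr. split; [apply Rabs_pos|apply Hc].
  - now apply ex_series_Rscal.
Qed.

Lemma l2_ext_summable (u v : nat -> C) :
  (forall n, u n = v n) -> ex_series (fun n => Cmod (u n) ^ 2) ->
  ex_series (fun n => Cmod (v n) ^ 2).
Proof. intros H. apply ex_series_Rext. intros n. now rewrite H. Qed.

(** The terms of the convergent series of [Cmod (f n) ^ 2] tend to 0, which forces [c ^ 2 <= 0]. *)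
Lemma l2_ge_const_eq_zero (f : l2) (c : R) : 0 <= c -> (forall n, c <= Cmod (f n)) -> c = 0.
Proof.
  intros Hc H.
  assert (L : is_lim_seq (fun n => Cmod (f n) ^ 2) 0)
    by apply ex_series_lim_0, l2_summable.
  assert (G : Rbar_le (c ^ 2) 0).
  { apply (is_lim_seq_le (fun _ => c ^ 2) (fun n => Cmod (f n) ^ 2)); [|apply is_lim_seq_const|exact L].
    intros n. apply pow_incr. split; [exact Hc|apply H]. }
  simpl in G. nra.
Qed.

(** By linearity the range contains every truncation [l2_trunc u N], and truncations of [g] converge
    to [g]. *)
Lemma dense_Ran_of_delta (A : bounded_op) :
  (forall n, Ran A (l2_delta n)) -> dense (Ran A).
Proof.
  intros HD. destruct (op_is_linear A) as [Ap As _].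
  assert (T : forall u N, Ran A (l2_trunc u N)).
  { intros u N. induction N as [|N [f Hf]].
    - rewrite l2_trunc_0. exists l2_zero.
      pose proof (As (RtoC 0) l2_zero) as E.
      change (A (l2_scal 0 l2_zero) = l2_scal 0 (A l2_zero)) in E.
      assert (Z : forall h, l2_scal 0 h = l2_zero) by (intros h; apply l2_ext; intros n; simpl; ring).
      now rewrite !Z in E.
    - destruct (HD N) as [d Hd]. exists (l2_plus f (l2_scal (u N) d)).
      rewrite l2_trunc_S, Hf, Hd.
      etransitivity; [|symmetry; exact (Ap f (l2_scal (u N) d))].
      change (l2_plus (A f) (l2_scal (u N) (A d)) = l2_plus (A f) (A (l2_scal (u N) d))).
      f_equal. symmetry. exact (As (u N) d). }
  intros g e. destruct (l2_trunc_approx g e (cond_pos e)) as [N HN].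
  exists (l2_trunc g N). split; [apply T|].
  apply ball_sym. exact HN.
Qed.

(** * The operator [M] for positive weights: inversion, range, density *)

Lemma partial_sum_pos (w : nat -> R) (hw : forall n, 0 < w n) (n : nat) : 0 < sum_n w n.
Proof.
  induction n as [|n IH]; [rewrite sum_O; apply hw|].
  rewrite sum_Sn. change plus with Rplus. specialize (hw (S n)). lra.
Qed.

(** Row [i] vanishes beyond column [i], so its series is a finite sum. With the denominator cleared,
    consecutive rows differ by one term, which yields the recurrence [weighted_mean_S]. *)
Lemma weighted_mean_sum (w : nat -> R) (hw : forall n, 0 < w n)
  (Hm : bounded_matrix (weighted_mean_matrix w)) (f : l2) (i : nat) :
  (RtoC (sum_n w i) * matrix_op _ Hm f i)%C = sum_n (fun j => RtoC (w j) * f j)%C i.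
Proof.
  simpl. unfold matrix_apply. rewrite (CSeries_finite _ i).
  2:{ intros n Hn. unfold weighted_mean_matrix. destruct (Nat.leb_spec n i); [lia|ring]. }
  pose proof (partial_sum_pos w hw i) as HW.
  rewrite <- (sum_n_mult_l (K := C_Ring)). apply sum_n_ext_loc. intros j Hj.
  unfold weighted_mean_matrix. destruct (Nat.leb_spec j i); [|lia].
  change (RtoC (sum_n w i) * (RtoC (w j / sum_n w i) * f j) = RtoC (w j) * f j)%C.
  rewrite RtoC_div by lra. field.
  intros E. apply RtoC_inj in E. lra.
Qed.

Lemma weighted_mean_0 (w : nat -> R) (hw : forall n, 0 < w n)
  (Hm : bounded_matrix (weighted_mean_matrix w)) (f : l2) : matrix_op _ Hm f O = f O.
Proof.
  pose proof (weighted_mean_sum w hw Hm f 0) as H. rewrite !sum_O in H.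
  specialize (hw O).
  apply (f_equal (Cmult (/ RtoC (w O)))) in H. rewrite !Cmult_assoc in H.
  rewrite Cinv_l, !Cmult_1_l in H; [exact H|]. intros E. apply RtoC_inj in E. lra.
Qed.

Lemma weighted_mean_S (w : nat -> R) (hw : forall n, 0 < w n)
  (Hm : bounded_matrix (weighted_mean_matrix w)) (f : l2) (n : nat) :
  (RtoC (sum_n w n + w (S n)) * matrix_op _ Hm f (S n))%C =
  (RtoC (sum_n w n) * matrix_op _ Hm f n + RtoC (w (S n)) * f (S n))%C.
Proof.
  rewrite weighted_mean_sum by exact hw.
  pose proof (weighted_mean_sum w hw Hm f (S n)) as H. rewrite !sum_Sn in H. exact H.
Qed.

Definition scaled_difference (w : nat -> R) (g : nat -> C) (n : nat) : C :=
  (RtoC (sum_n w n / w (S n)) * (g (S n) - g n))%C.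

Lemma weighted_mean_inverse (w : nat -> R) (hw : forall n, 0 < w n)
  (Hm : bounded_matrix (weighted_mean_matrix w)) (f : l2) (n : nat) :
  f (S n) = (matrix_op _ Hm f (S n) + scaled_difference w (matrix_op _ Hm f) n)%C.
Proof.
  pose proof (weighted_mean_S w hw Hm f n) as H. unfold scaled_difference.
  specialize (hw (S n)).
  assert (RtoC (w (S n)) <> 0) by (intros E; apply RtoC_inj in E; lra).
  rewrite RtoC_plus in H. rewrite RtoC_div by lra.
  generalize dependent (matrix_op _ Hm f). intros g H.
  replace (f (S n)) with ((RtoC (w (S n)) * f (S n)) / RtoC (w (S n)))%C by (field; assumption).
  replace (RtoC (w (S n)) * f (S n))%C with
    ((RtoC (sum_n w n) + RtoC (w (S n))) * g (S n) - RtoC (sum_n w n) * g n)%C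
    by (rewrite H; ring).
  field; assumption.
Qed.

Lemma weighted_mean_injective (w : nat -> R) (hw : forall n, 0 < w n)
  (Hm : bounded_matrix (weighted_mean_matrix w)) : Injective (matrix_op _ Hm).
Proof.
  intros f g E. apply l2_ext. intros [|n].
  - rewrite <- (weighted_mean_0 w hw Hm f), <- (weighted_mean_0 w hw Hm g). now rewrite E.
  - rewrite (weighted_mean_inverse w hw Hm f), (weighted_mean_inverse w hw Hm g). now rewrite E.
Qed.

(** Converse of [weighted_mean_inverse]: [M f] and [g] agree at 0 and satisfy the same first-order
    recurrence. *)
Lemma weighted_mean_eq (w : nat -> R) (hw : forall n, 0 < w n)
  (Hm : bounded_matrix (weighted_mean_matrix w)) (f g : l2) :
  f O = g O -> (forall n, f (S n) = (g (S n) + scaled_difference w g n)%C) ->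
  matrix_op _ Hm f = g.
Proof.
  intros H0 HS. apply l2_ext. induction n as [|n IH].
  - now rewrite weighted_mean_0.
  - pose proof (weighted_mean_S w hw Hm f n) as E. rewrite IH, HS in E.
    pose proof (partial_sum_pos w hw n). specialize (hw (S n)).
    assert (H1 : RtoC (w (S n)) <> 0) by (intros Z; apply RtoC_inj in Z; lra).
    assert (H2 : RtoC (sum_n w n + w (S n)) <> 0) by (intros Z; apply RtoC_inj in Z; lra).
    apply (f_equal (Cmult (/ RtoC (sum_n w n + w (S n))))) in E.
    rewrite Cmult_assoc, Cinv_l, Cmult_1_l in E by assumption.
    rewrite E. unfold scaled_difference. rewrite RtoC_div by lra.
    rewrite RtoC_plus in *. field. split; assumption.
Qed.

(** The triangular system always has a unique formal solution [f], the shift of [g] plus [d]; as [g]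
    is in [l2], only the summability of [d] is at stake. *)
Lemma Ran_weighted_mean (w : nat -> R) (hw : forall n, 0 < w n)
  (Hm : bounded_matrix (weighted_mean_matrix w)) (g : l2) :
  Ran (matrix_op _ Hm) g <-> ex_series (fun n => Cmod (scaled_difference w g n) ^ 2).
Proof.
  split.
  - intros [f ->]. set (g := matrix_op _ Hm f).
    apply l2_ext_summable with (fun n => (f (S n) + - g (S n))%C).
    { intros n. rewrite (weighted_mean_inverse w hw Hm f n). fold g. ring. }
    apply l2_summable_plus; [|apply l2_summable_opp];
      apply (proj1 (l2_summable_shift _)), l2_summable.
  - intros H.
    set (u := fun n => match n with O => g O | S k => (g (S k) + scaled_difference w g k)%C end).
    assert (Hu : ex_series (fun n => Cmod (u n) ^ 2)).
    { apply l2_summable_shift. simpl.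
      apply l2_summable_plus; [|exact H]. apply (proj1 (l2_summable_shift _)), l2_summable. }
    exists (mk_l2 u Hu). symmetry. now apply weighted_mean_eq.
Qed.

(** Column [n] of the inverse matrix, divided by [W n]. Multiplied by the weights, its entries are 1
    at [n] and -1 at [n+1], so their partial sums are 1 at [n] and 0 elsewhere. *)
Definition delta_preimage (w : nat -> R) (n : nat) : l2 :=
  l2_plus (l2_scal (RtoC (/ w n)) (l2_delta n)) (l2_scal (RtoC (- / w (S n))) (l2_delta (S n))).

Lemma weighted_mean_delta_preimage (w : nat -> R) (hw : forall n, 0 < w n)
  (Hm : bounded_matrix (weighted_mean_matrix w)) (n : nat) :
  matrix_op _ Hm (delta_preimage w n) = l2_scal (RtoC (/ sum_n w n)) (l2_delta n).
Proof.
  assert (N0 : forall x, 0 < x -> RtoC x <> 0) by (intros x Hx Z; apply RtoC_inj in Z; lra).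
  apply weighted_mean_eq; [exact hw| |].
  - simpl. destruct n as [|n]; simpl; [rewrite sum_O|]; ring.
  - intros k. unfold scaled_difference.
    pose proof (partial_sum_pos w hw k) as Hk. pose proof (hw (S k)) as Hwk.
    assert (ES : sum_n w (S k) = sum_n w k + w (S k)) by (rewrite sum_Sn; reflexivity).
    pose proof (hw n) as Hn. pose proof (hw (S n)) as HSn.
    (* Both sides vanish unless [k + 1 = n] or [k = n]; splitting on [n] lets the index tests reduce
       to these cases. *)
    simpl. destruct n as [|n].
    + destruct (Nat.eqb_spec k 0) as [->|]; [|ring].
      rewrite RtoC_div, RtoC_opp, !RtoC_inv by lra. field. repeat split; apply N0; assumption.
    + destruct (Nat.eqb_spec k n) as [->|Hkn].
      * destruct (Nat.eqb_spec n (S n)); [lia|].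
        rewrite ES, RtoC_div, !RtoC_inv by lra. rewrite RtoC_plus. field.
        rewrite <- RtoC_plus. repeat split; apply N0; lra.
      * destruct (Nat.eqb_spec k (S n)) as [->|]; [|ring].
        rewrite RtoC_div, RtoC_opp, !RtoC_inv by lra. field. repeat split; apply N0; assumption.
Qed.

Lemma dense_Ran_weighted_mean (w : nat -> R) (hw : forall n, 0 < w n)
  (Hm : bounded_matrix (weighted_mean_matrix w)) : dense (Ran (matrix_op _ Hm)).
Proof.
  apply dense_Ran_of_delta. intros n.
  exists (l2_scal (RtoC (sum_n w n)) (delta_preimage w n)).
  destruct (op_is_linear (matrix_op _ Hm)) as [_ As _].
  specialize (As (RtoC (sum_n w n)) (delta_preimage w n)).
  rewrite weighted_mean_delta_preimage in As by exact hw.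
  etransitivity; [|symmetry; exact As].
  apply l2_ext. intros k. simpl. change scal with Cmult.
  rewrite Cmult_assoc, <- RtoC_mult, Rinv_r; [ring|].
  apply Rgt_not_eq, partial_sum_pos, hw.
Qed.

(** * The adjoint and its range, without computing its infinite row sums *)

(* Obtained by pairing with [M (delta_preimage w n) = delta n / W n]. *)
Lemma adjoint_weighted_mean_diff (w : nat -> R) (hw : forall n, 0 < w n)
  (Hm : bounded_matrix (weighted_mean_matrix w)) (k : l2) (n : nat) :
  let h := adjoint (matrix_op _ Hm) k in
  (RtoC (/ w n) * h n - RtoC (/ w (S n)) * h (S n))%C = (RtoC (/ sum_n w n) * k n)%C.
Proof.
  intros h. pose proof (adjoint_spec (matrix_op _ Hm) (delta_preimage w n) k) as E.
  fold h in E. rewrite weighted_mean_delta_preimage in E by exact hw.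
  unfold delta_preimage in E.
  rewrite l2_inner_plus_l, !l2_inner_scal_l, !l2_inner_delta_l in E.
  apply (f_equal Cconj) in E.
  rewrite Cplus_conj, !Cmult_conj, !Cconj_conj in E.
  assert (R : forall x, Cconj (RtoC x) = RtoC x)
    by (intros x; unfold Cconj, RtoC; simpl; f_equal; ring).
  rewrite !R in E. rewrite E, RtoC_opp. ring.
Qed.

Lemma adjoint_weighted_mean_inverse (w : nat -> R) (hw : forall n, 0 < w n)
  (Hm : bounded_matrix (weighted_mean_matrix w)) (k : l2) (n : nat) :
  let h := adjoint (matrix_op _ Hm) k in
  k n = (RtoC (sum_n w n) * (RtoC (/ w n) * h n - RtoC (/ w (S n)) * h (S n)))%C.
Proof.
  intros h. unfold h. rewrite (adjoint_weighted_mean_diff w hw Hm k n).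
  rewrite Cmult_assoc, <- RtoC_mult, Rinv_r; [ring|].
  apply Rgt_not_eq, partial_sum_pos, hw.
Qed.

Lemma adjoint_weighted_mean_injective (w : nat -> R) (hw : forall n, 0 < w n)
  (Hm : bounded_matrix (weighted_mean_matrix w)) : Injective (adjoint (matrix_op _ Hm)).
Proof.
  intros f g E. apply l2_ext. intros n.
  rewrite (adjoint_weighted_mean_inverse w hw Hm f), (adjoint_weighted_mean_inverse w hw Hm g).
  now rewrite E.
Qed.

(* The differences determine [h / w] up to a constant [c], and [c w] is square-summable
   only for [c = 0] since [w] is bounded below. *)
Lemma adjoint_weighted_mean_eq (w : nat -> R) (b : R) (hb : 0 < b) (hw : forall n, b <= w n)
  (Hm : bounded_matrix (weighted_mean_matrix w)) (k h : l2) :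
  (forall n, k n = (RtoC (sum_n w n) * (RtoC (/ w n) * h n - RtoC (/ w (S n)) * h (S n)))%C) ->
  adjoint (matrix_op _ Hm) k = h.
Proof.
  intros Hk. assert (hw0 : forall n, 0 < w n) by (intros n; specialize (hw n); lra).
  set (h' := adjoint (matrix_op _ Hm) k).
  set (r := l2_plus h' (l2_opp h)).
  assert (N0 : forall x, 0 < x -> RtoC x <> 0) by (intros x Hx Z; apply RtoC_inj in Z; lra).
  assert (S1 : forall n, (RtoC (/ w (S n)) * r (S n))%C = (RtoC (/ w n) * r n)%C).
  { intros n. pose proof (adjoint_weighted_mean_diff w hw0 Hm k n) as E.
    cbv zeta in E. fold h' in E. rewrite Hk in E.
    pose proof (partial_sum_pos w hw0 n) as HW.
    rewrite (Cmult_assoc (RtoC (/ sum_n w n))), <- RtoC_mult, Rinv_l, Cmult_1_l in E by lra.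
    unfold r. simpl. rewrite RtoC_m1.
    transitivity ((RtoC (/ w n) * h' n - (RtoC (/ w n) * h' n - RtoC (/ w (S n)) * h' (S n)))
      - RtoC (/ w (S n)) * h (S n))%C; [ring|]. rewrite E. ring. }
  set (c := (RtoC (/ w O) * r O)%C).
  assert (S2 : forall n, (RtoC (/ w n) * r n)%C = c).
  { induction n as [|n IH]; [reflexivity|]. now rewrite S1. }
  assert (S3 : forall n, r n = (RtoC (w n) * c)%C).
  { intros n. rewrite <- (S2 n), Cmult_assoc, <- RtoC_mult, Rinv_r; [ring|].
    apply Rgt_not_eq, hw0. }
  assert (c0 : c = RtoC 0).
  { apply Cmod_eq_0. pose proof (Cmod_ge_0 c) as Hc.
    assert (H : b * Cmod c = 0).
    { apply (l2_ge_const_eq_zero r); [nra|]. intros n.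
      rewrite S3, Cmod_mult, Cmod_R, Rabs_pos_eq by (specialize (hw0 n); lra).
      specialize (hw n). nra. }
    nra. }
  apply l2_ext. intros n. specialize (S3 n). rewrite c0 in S3.
  unfold r in S3. simpl in S3. rewrite RtoC_m1 in S3.
  replace (h' n) with ((h' n + - (1) * h n) + h n)%C by ring. rewrite S3. ring.
Qed.

(** The only candidate preimage of [h] is a bounded multiple of [h n] minus [d n]. The bound [K]
    makes the first term square-summable, so the criterion is the one for [M]. *)
Lemma Ran_adjoint_weighted_mean (w : nat -> R) (b K : R) (hb : 0 < b) (hw : forall n, b <= w n)
  (hK : forall n, Rabs (sum_n w n * (/ w n - / w (S n))) <= K)
  (Hm : bounded_matrix (weighted_mean_matrix w)) (h : l2) :
  Ran (adjoint (matrix_op _ Hm)) h <->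
  ex_series (fun n => Cmod (scaled_difference w h n) ^ 2).
Proof.
  assert (hw0 : forall n, 0 < w n) by (intros n; specialize (hw n); lra).
  (* Adding and subtracting [W n / w (n+1) * g n] separates the multiplier from the difference. *)
  assert (D : forall (g : l2) n,
    (RtoC (sum_n w n) * (RtoC (/ w n) * g n - RtoC (/ w (S n)) * g (S n)))%C =
    (RtoC (sum_n w n * (/ w n - / w (S n))) * g n + - scaled_difference w g n)%C).
  { intros g n. unfold scaled_difference, Rdiv. rewrite !RtoC_mult, RtoC_minus. ring. }
  split.
  - intros [k ->]. set (g := adjoint (matrix_op _ Hm) k).
    apply l2_ext_summable with
      (fun n => (RtoC (sum_n w n * (/ w n - / w (S n))) * g n + - k n)%C).
    { intros n. rewrite (adjoint_weighted_mean_inverse w hw0 Hm k n). fold g.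
      rewrite D. ring. }
    apply l2_summable_plus; [|apply l2_summable_opp, l2_summable].
    apply l2_summable_mult_bounded with K; [exact hK|apply l2_summable].
  - intros H.
    (* By [D], this is the preimage dictated by [adjoint_weighted_mean_inverse]. *)
    set (u := fun n =>
      (RtoC (sum_n w n * (/ w n - / w (S n))) * h n + - scaled_difference w h n)%C).
    assert (Hu : ex_series (fun n => Cmod (u n) ^ 2)).
    { apply l2_summable_plus; [|now apply l2_summable_opp].
      apply l2_summable_mult_bounded with K; [exact hK|apply l2_summable]. }
    exists (mk_l2 u Hu). symmetry. apply adjoint_weighted_mean_eq with b; [assumption..|].
    intros n. now rewrite D.
Qed.

(** * Affine weights and the equality of ranges *)

(** Since [1 / w n - 1 / w (n+1) = a / (w n * w (n+1))] and [W n = (n+1) * (a n / 2 + b)], the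
    factor is the product of [a (n+1) / w (n+1)] and [(a n / 2 + b) / w n], both in [0, 1]. *)
Lemma affine_weight_bound (a b : R) (ha : 0 < a) (hb : 0 < b) (n : nat) :
  let w := fun n : nat => a * INR n + b in
  Rabs (sum_n w n * (/ w n - / w (S n))) <= 1.
Proof.
  intros w. unfold w. rewrite affine_partial_sum, S_INR.
  pose proof (pos_INR n) as Hn. set (x := INR n) in *.
  assert (0 <= a * x) by nra.
  replace ((x + 1) * (a * x / 2 + b) * (/ (a * x + b) - / (a * (x + 1) + b))) with
    ((a * (x + 1) / (a * (x + 1) + b)) * ((a * x / 2 + b) / (a * x + b))) by (field; lra).
  assert (U : forall p q, 0 <= p <= q -> 0 < q -> 0 <= p / q <= 1).
  { intros p q Hp Hq. split.
    - apply Rmult_le_pos; [lra|]. now apply Rlt_le, Rinv_0_lt_compat.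
    - apply Rmult_le_reg_r with q; [exact Hq|]. unfold Rdiv.
      rewrite Rmult_assoc, Rinv_l; lra. }
  destruct (U (a * (x + 1)) (a * (x + 1) + b)); [lra..|].
  destruct (U (a * x / 2 + b) (a * x + b)); [lra..|].
  rewrite Rabs_pos_eq by nra. nra.
Qed.

Theorem theorem3p3 (a b : R) (ha : 0 < a) (hb : 0 < b) :
  let w := fun n : nat => a * INR n + b in
  let M := matrix_op (weighted_mean_matrix w) (affine_weighted_mean_bounded a b ha hb) in
  (Injective M /\ dense (Ran M)) /\
  (Injective (adjoint M) /\ dense (Ran (adjoint M))) /\
  (forall g : l2, Ran M g <-> Ran (adjoint M) g).
Proof.
  intros w M.
  assert (hwb : forall n, b <= w n).
  { intros n. unfold w. pose proof (pos_INR n). nra. }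
  assert (hw : forall n, 0 < w n) by (intros n; specialize (hwb n); lra).
  assert (R : forall g, Ran M g <-> Ran (adjoint M) g).
  { intros g. unfold M. rewrite Ran_weighted_mean by exact hw.
    rewrite (Ran_adjoint_weighted_mean w b 1 hb hwb (affine_weight_bound a b ha hb)).
    reflexivity. }
  assert (D : dense (Ran M)) by now apply dense_Ran_weighted_mean.
  split; [|split]; [split| split |].
  - now apply weighted_mean_injective.
  - exact D.
  - now apply adjoint_weighted_mean_injective.
  (* Density for the adjoint is inherited from [M] through the equality of ranges. *)
  - intros g e. destruct (D g e) as [h [Hh Hb]]. exists h. split; [now apply R|exact Hb].
  - exact R.
Qed.
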